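(* Let $\tau$ be a generic Euclidean triangle with triangle group $G_\tau=\langle r_1,r_2,r_3\rangle$ and rotation subgroup $H_\tau$ (see context). Then $H_\tau$ admits the presentation $$\langle y_2,y_3 \mid [\,c,\ (y_2^ny_3^m)^{-1}\,c\,(y_2^ny_3^m)\,]\ \text{ for } n,m\in\mathbb{Z},\ (n,m)>(0,0)\rangle,\qquad c=[y_2,y_3],$$ with $y_2$ corresponding to the rotation $r_2r_1$ and $y_3$ corresponding to the rotation $r_1r_3$.
   Context: A Euclidean triangle $\tau=A_1A_2A_3$ has edges $e_i=A_jA_k$ of length $\ell_i>0$, $\{i,j,k\}=\{1,2,3\}$. It is generic if for some real $k>0$ the numbers $k\ell_1,k\ell_2,k\ell_3$ are algebraically independent over $\mathbb{Q}$. Let $r_i$ be the reflection of the plane across the line containing $e_i$ and $G_\tau=\langle r_1,r_2,r_3\rangle\subset \mathrm{E}(2)$, with products composed left to right ($(x)gh=((x)g)h$). $H_\tau=G_\tau\cap\mathrm{SE}(2)$ is the subgroup of orientation-preserving elements. Commutators are $[a,b]=aba^{-1}b^{-1}$. The order on pairs is lexicographic: $(n,m)>(0,0)$ means $n>0$, or $n=0$ and $m>0$. *)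

(* Defs.v *)
From HB Require Import structures.
From mathcomp Require Import all_boot all_order all_algebra.
From mathcomp Require Import reals.
From mathcomp Require Import mpoly.
Set Implicit Arguments. Unset Strict Implicit. Unset Printing Implicit Defensive.
Import Order.TTheory GRing.Theory Num.Theory.
Local Open Scope ring_scope.

Section Geometry.
Variable R : realType.

(* An affine map of the plane x |-> x *m A + b (row vectors, right action). *)
Definition aff := ('M[R]_2 * 'rV[R]_2)%type.

(* Left-to-right product: (x)(g h) = ((x)g)h. *)
Definition amul (g h : aff) : aff := (g.1 *m h.1, g.2 *m h.1 + h.2).
Definition aone : aff := (1%:M, 0).
Definition ainv (g : aff) : aff := (invmx g.1, - (g.2 *m invmx g.1)).

Definition dot (u v : 'rV[R]_2) : R := (u *m v^T) 0 0.
Definition dist (P Q : 'rV[R]_2) : R := Num.sqrt (dot (Q - P) (Q - P)).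

(* reflection of the plane across the line through P and Q (P <> Q):
   x |-> P + (x - P) M with M = (2/|d|^2) d^T d - 1, d = Q - P. *)
Definition reflM (P Q : 'rV[R]_2) : 'M[R]_2 :=
  ((2 / dot (Q - P) (Q - P)) *: ((Q - P)^T *m (Q - P))) - 1%:M.
Definition refl (P Q : 'rV[R]_2) : aff := (reflM P Q, P - P *m reflM P Q).

Definition is_triangle (A1 A2 A3 : 'rV[R]_2) : Prop :=
  \det (col_mx (A2 - A1) (A3 - A1)) != 0.

Definition alg_indep3 (t : 'I_3 -> R) : Prop :=
  forall p : {mpoly rat[3]}, p != 0 -> mmap (@ratr R) t p != 0.

Definition generic_triangle (A1 A2 A3 : 'rV[R]_2) : Prop :=
  exists k : R, 0 < k /\
    alg_indep3 (fun i : 'I_3 =>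
      k * [:: dist A2 A3; dist A3 A1; dist A1 A2]`_i).

Definition r1 (A1 A2 A3 : 'rV[R]_2) : aff := refl A2 A3.
Definition r2 (A1 A2 A3 : 'rV[R]_2) : aff := refl A3 A1.
Definition r3 (A1 A2 A3 : 'rV[R]_2) : aff := refl A1 A2.

(* G_tau = <r1,r2,r3>: since the r_i are involutions, its elements are the
   finite products of the r_i. *)
Definition in_G (A1 A2 A3 : 'rV[R]_2) (g : aff) : Prop :=
  exists s : seq 'I_3,
    g = foldr (fun (i : 'I_3) acc =>
                 amul ([:: r1 A1 A2 A3; r2 A1 A2 A3; r3 A1 A2 A3]`_i) acc)
              aone s.

Definition in_H (A1 A2 A3 : 'rV[R]_2) (g : aff) : Prop :=
  in_G A1 A2 A3 g /\ \det g.1 = 1.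

End Geometry.

(* a letter (b, e): b = false is y2, b = true is y3; e = true means inverse *)
Definition letter := (bool * bool)%type.
Definition winv (w : seq letter) : seq letter :=
  rev (map (fun l => (l.1, ~~ l.2)) w).

Definition wpow (b : bool) (n : int) : seq letter :=
  match n with
  | Posz k => nseq k (b, false)
  | Negz k => nseq k.+1 (b, true)
  end.

Definition y2 : seq letter := [:: (false, false)].
Definition y3 : seq letter := [:: (true, false)].
Definition wcomm (a b : seq letter) := a ++ b ++ winv a ++ winv b.
Definition wc : seq letter := wcomm y2 y3.
Definition relator (n m : int) : seq letter :=
  let g := wpow false n ++ wpow true m in
  wcomm wc (winv g ++ wc ++ g).

Definition lex_pos (n m : int) : bool := (0 < n) || ((n == 0) && (0 < m)).

Inductive elem_step : seq letter -> seq letter -> Prop :=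
  | step_free (u v : seq letter) (l : letter) :
      elem_step (u ++ [:: l; (l.1, ~~ l.2)] ++ v) (u ++ v)
  | step_rel (u v : seq letter) (n m : int) :
      lex_pos n m -> elem_step (u ++ relator n m ++ v) (u ++ v).

Inductive pres_eq : seq letter -> seq letter -> Prop :=
  | pe_refl w : pres_eq w w
  | pe_step w1 w2 : elem_step w1 w2 -> pres_eq w1 w2
  | pe_sym w1 w2 : pres_eq w1 w2 -> pres_eq w2 w1
  | pe_trans w1 w2 w3 : pres_eq w1 w2 -> pres_eq w2 w3 -> pres_eq w1 w3.

Definition weval (R : realType) (g2 g3 : aff R) (w : seq letter) : aff R :=
  foldr (fun l acc =>
           amul (let g := if l.1 then g3 else g2 in
                 if l.2 then ainv g else g) acc)
        (aone R) w.

(* Main.v *)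
Require Import Defs.
From HB Require Import structures.
From mathcomp Require Import all_boot all_order all_algebra.
From mathcomp Require Import boolp reals.
From mathcomp Require Import complex mpoly.
From mathcomp Require Import zify ring lra.
Set Implicit Arguments. Unset Strict Implicit. Unset Printing Implicit Defensive.
Import Order.TTheory GRing.Theory Num.Theory.
Local Open Scope ring_scope.

(** H_tau is the free metabelian group of rank two.

    In the presented group write c(n,m) for the conjugate of c by y2^n y3^m.
    The relators say that c(0,0) commutes with c(n,m) for (n,m) > (0,0);
    conjugating them by y2 and y3, column by column, all the c(n,m) commute, so
    every element is y2^a y3^b times a product of the c(n,m) and their inverses,
    determined by a, b and an element of the Laurent ring Z[u,v].

    In H_tau the linear parts u2, u3 of the two rotations are complex numbers,
    c is a nonzero translation by tau, and c(n,m) is the translation by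
    tau u2^n u3^m.  Hence the theorem reduces to the algebraic independence of u2
    and u3.  Both lie in Q(l1,l2,l3)(S) with S = 4 i Area, and the l_i are
    independent, so a relation between u2 and u3 is an identity in l1, l2, l3, S
    subject only to Heron's formula for S^2.  It therefore survives the
    specialisation l1 = pq - 1/(pq), l2 = p - 1/p, l3 = q - 1/q, S = - l1 l2 l3,
    that is, sines of the angles of a "triangle" with imaginary angles, where
    u2 = q^2 and u3 = p^2; letting p and q vary makes the relation trivial. *)

(** * The relators make all conjugates of the commutator commute *)

Lemma int_shift_ind (P : int -> Prop) :
  P 0 -> (forall m, P m -> P (m + 1)) -> (forall m, P (m + 1) -> P m) ->
  forall m, P m.
Proof.
move=> P0 PS PP; elim=> [|n IH|n IH] //.
- by rewrite intS addrC; apply: PS.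
- by apply: PP; rewrite intS opprD addrC addNKr.
Qed.

Section IntegerPowers.
Variable G : groupType.
Implicit Types g a b d : G.
Local Open Scope group_scope.

(** Split along the constructors of [int] exactly as [wpow], so that the class of a power word is a
    [zexpg] by case analysis. *)
Definition zexpg g (n : int) : G :=
  match n with Posz k => g ^+ k | Negz k => (g ^+ k.+1)^-1 end.

Lemma zexpg0 g : zexpg g 0 = 1. Proof. by []. Qed.

Lemma zexpgS g n : zexpg g (n + 1)%R = zexpg g n * g.
Proof.
case: n => n; first by rewrite -PoszD addn1 /= expgSr.
have -> : (Negz n + 1 = - n%:Z)%R by rewrite NegzE intS opprD addrAC addNr add0r.
case: n => [|n]; first by rewrite /= expg1 mulVg.
by rewrite -NegzE /= (expgS g n.+1) invgM mulgVK.
Qed.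

Lemma zexpgP g n : zexpg g (n - 1)%R = zexpg g n * g^-1.
Proof. by apply: (mulIg g); rewrite -zexpgS subrK mulgVK. Qed.

Lemma zexpgD g n m : zexpg g (n + m)%R = zexpg g n * zexpg g m.
Proof.
elim/int_shift_ind: m => [|m IH|m IH]; first by rewrite addr0 mulg1.
- by rewrite addrA !zexpgS IH mulgA.
- by apply: (mulIg g); rewrite -mulgA -!zexpgS -addrA IH.
Qed.

Lemma commuteJ a b g : commute a b -> commute (a ^ g) (b ^ g).
Proof. by rewrite /commute -!conjMg => ->. Qed.

(** Conjugation by [g] fixes [b], so the hypothesis is the conclusion conjugated by [g]. *)
Lemma commute_conjl a b g : commute g b -> commute (a ^ g) b -> commute a b.
Proof.
move=> cgb cab; rewrite -(conjgK g a) -[b](conjgK g b).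
by apply: commuteJ; rewrite [b ^ g]conjgE -cgb mulKg.
Qed.

Lemma conjg_commute a g : commute a g -> a ^ g = a.
Proof. by rewrite conjgE => ->; rewrite mulKg. Qed.

End IntegerPowers.

Section Metabelian.
Variables (G : groupType) (x y : G).
Local Open Scope group_scope.

Let c := x * (y * (x^-1 * y^-1)).

Definition ccomm (n m : int) : G := c ^ (zexpg x n * zexpg y m).
(* Conjugation by [x] shifts columns only up to [kcomm m], a product of elements
   of column 1 (see [kcommS]). *)
Let kcomm (m : int) : G := (zexpg y m)^-1 * (x^-1 * (zexpg y m * x)).

Hypothesis ccomm_rel : forall n m, lex_pos n m -> commute c (ccomm n m).

Lemma ccomm00 : ccomm 0 0 = c.
Proof. by rewrite /ccomm !zexpg0 mulg1 conjg1. Qed.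

Lemma ccommJy n m q : ccomm n m ^ zexpg y q = ccomm n (m + q)%R.
Proof. by rewrite /ccomm -conjgM zexpgD mulgA. Qed.

(** Moving [x] to the left across [y^m] leaves a factor behind: [y^m x = x y^m (kcomm m)]. *)
Lemma ccommJx n m : ccomm n m ^ x = ccomm (n + 1)%R m ^ kcomm m.
Proof. by rewrite /ccomm -!conjgM zexpgS /kcomm -!mulgA mulVKg mulVKg. Qed.

Lemma kcomm0 : kcomm 0 = 1. Proof. by rewrite /kcomm zexpg0 invg1 !mul1g mulVg. Qed.

Lemma kcommS m : kcomm (m + 1)%R = (ccomm 1 (m + 1)%R)^-1 * kcomm m.
Proof.
rewrite addrC /kcomm /ccomm zexpgD /c !conjgE /=.
by rewrite !invgM !invgK -!mulgA !(mulKg, mulVKg).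
Qed.

Lemma commute_kcomm d : (forall q, commute (ccomm 1 q) d) ->
  forall q, commute (kcomm q) d.
Proof.
move=> cd; elim/int_shift_ind => [|q IH|q IH].
- by rewrite kcomm0; apply/commute_sym/commute1.
- rewrite kcommS; apply/commute_sym/commuteM; last exact: commute_sym.
  exact/commuteV/commute_sym.
- have -> : kcomm q = ccomm 1 (q + 1)%R * kcomm (q + 1)%R by rewrite kcommS mulVKg.
  by apply/commute_sym/commuteM; apply/commute_sym.
Qed.

(** Conjugating a relator by [y^a] moves both rows by [a], so only the difference of the rows
    matters. Inside column 0 that difference may be negative, and symmetry of commutation covers
    it. *)
Lemma ccomm_col0 n q m : (0 <= n)%R -> commute (ccomm 0 q) (ccomm n m).
Proof.
have pos a b : lex_pos n (b - a)%R -> commute (ccomm 0 a) (ccomm n b).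
  move=> /ccomm_rel/(@commuteJ _ _ _ (zexpg y a)).
  by rewrite -ccomm00 !ccommJy add0r subrK.
case: ltrgt0P => // [n0 _|n0 _]; first by apply: pos; rewrite /lex_pos n0.
rewrite n0 in pos *; case: (ltrgtP q m) => [qm|mq|->].
- by apply: pos; rewrite /lex_pos subr_gt0 qm.
- by apply/commute_sym/pos; rewrite /lex_pos subr_gt0 mq.
- exact: commute_refl.
Qed.

(** Conjugating by [x] the commutation of column 0 with column [n - 1] gives column 1 against column
    [n], up to the factors [kcomm]. In row 0 of column [n] this factor is 1, which leaves only the
    one on column 1 to remove; powers of [y] then reach the other rows. *)
Lemma ccomm_col1 n q m : (0 <= n)%R -> commute (ccomm 1 q) (ccomm n m).
Proof.
move=> n0; case: (eqVneq n 0) => [->|nn0].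
  exact/commute_sym/ccomm_col0.
have n1 : (0 <= n - 1)%R by lia.
have conjk r : commute (ccomm 1 r ^ kcomm r) (ccomm n 0).
  have := commuteJ x (ccomm_col0 r 0 n1).
  by rewrite !ccommJx kcomm0 conjg1 subrK.
have step r : commute (kcomm r) (ccomm n 0) -> commute (ccomm 1 r) (ccomm n 0).
  by move=> kr; apply: commute_conjl kr _.
(* The factor by which [kcomm r] and [kcomm (r + 1)] differ cancels in
   [ccomm 1 (r + 1) ^ kcomm (r + 1)], so the induction on [r] does not get stuck. *)
have kn r : commute (kcomm r) (ccomm n 0).
  elim/int_shift_ind: r => [|r IH|r IH].
  - by rewrite kcomm0; apply/commute_sym/commute1.
  - have z : commute (ccomm 1 (r + 1)%R) (ccomm n 0).
      apply: commute_conjl (IH) _; have := conjk (r + 1)%R.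
      by rewrite kcommS conjgM [_ ^ _^-1]conjg_commute //; apply/commuteV/commute_refl.
    by rewrite kcommS; apply/commute_sym/commuteM;
       [apply/commuteV/commute_sym | apply/commute_sym].
  - have -> : kcomm r = ccomm 1 (r + 1)%R * kcomm (r + 1)%R by rewrite kcommS mulVKg.
    by apply/commute_sym/commuteM; apply/commute_sym => //; apply: step.
have := commuteJ (zexpg y m) (step _ (kn (q - m)%R)).
by rewrite !ccommJy add0r subrK.
Qed.

Lemma ccommJx_nonneg n m : (0 <= n + 1)%R -> ccomm n m ^ x = ccomm (n + 1)%R m.
Proof.
move=> n0; rewrite ccommJx conjg_commute //.
by apply/commute_sym/commute_kcomm => q; apply: ccomm_col1.
Qed.

(** With the columns written as [a] and [a + b], induction on [a] starts at column 0, and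
    conjugation by [x] shifts both columns at once. *)
Lemma ccomm_nonneg n p q m : (0 <= n)%R -> (0 <= p)%R ->
  commute (ccomm n q) (ccomm p m).
Proof.
suff diff (a b : nat) r s : commute (ccomm a r) (ccomm (a + b)%N s).
  case: n p => // n [] // p _ _; case: (leqP n p) => [le|/ltnW le].
    by rewrite -(subnKC le).
  by rewrite -(subnKC le); apply/commute_sym.
elim: a => [|a IH]; first exact: ccomm_col0.
by have := commuteJ x IH; rewrite !ccommJx_nonneg -?PoszD ?addn1.
Qed.

(** Induction on a lower bound [- s] for the columns. By the induction hypothesis column 1, hence
    every [kcomm], commutes with columns from [- s] on; so [x^-1] carries these columns exactly one
    step further left. *)
Theorem ccomm_commute n p q m : commute (ccomm n q) (ccomm p m).
Proof.
suff bound (s : nat) a b r t : (- s%:Z <= a)%R -> (- s%:Z <= b)%R ->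
    commute (ccomm a r) (ccomm b t).
  by apply: (bound (`|n| + `|p|)%N); lia.
elim: s a b r t => [|s IH] a b r t; first by rewrite oppr0; apply: ccomm_nonneg.
have Jx d u : (- s.+1%:Z <= d)%R -> ccomm d u = ccomm (d + 1)%R u ^ x^-1.
  move=> sd; rewrite -(conjgK x (ccomm d u)) ccommJx.
  congr (_ ^ _); apply: conjg_commute.
  by apply/commute_sym/commute_kcomm => v; apply: IH; lia.
by move=> sa sb; rewrite (Jx a) // (Jx b) //; apply/commuteJ/IH; lia.
Qed.

Lemma ccomm_shiftx n m : ccomm n m ^ x = ccomm (n + 1)%R m.
Proof.
rewrite ccommJx conjg_commute //; apply/commute_sym/commute_kcomm => q.
exact: ccomm_commute.
Qed.

Lemma ccomm_shifty n m : ccomm n m ^ y = ccomm n (m + 1)%R.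
Proof. by rewrite -ccommJy. Qed.

Definition cprod (s : seq (int * int)) : G := \big[*%g/1]_(p <- s) ccomm p.1 p.2.

Lemma cprod_cat s t : cprod (s ++ t) = cprod s * cprod t.
Proof. exact: big_cat. Qed.

Lemma cprod_commute s t : commute (cprod s) (cprod t).
Proof.
apply: commute_prod => p _; apply/commute_sym/commute_prod => q _.
exact: ccomm_commute.
Qed.

Lemma perm_cprod s t : perm_eq s t -> cprod s = cprod t.
Proof.
elim: s t => [|p s IH] t st; first by move: (perm_size st); case: t {st}.
have pt : p \in t by rewrite -(perm_mem st) mem_head.
case/splitPr: pt st => t1 t2; rewrite perm_sym perm_catC /= perm_cons.
rewrite perm_catC perm_sym => /IH st.
rewrite -cat1s -[p :: t2]cat1s !cprod_cat mulgA (cprod_commute t1) -mulgA.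
by rewrite st cprod_cat.
Qed.

(** The quotient of two products encodes an element of Z[u,v] as a difference of two multisets of
    exponents, which avoids signed coefficients. The name anticipates the image in H_tau. *)
Definition translation (z : G) : Prop := exists s t, z = cprod s * (cprod t)^-1.

Lemma translation1 : translation 1.
Proof. by exists [::], [::]; rewrite mulgV. Qed.

Lemma translation_ccomm n m : translation (ccomm n m).
Proof.
by exists [:: (n, m)], [::]; rewrite /cprod big_nil big_seq1 invg1 mulg1.
Qed.

Lemma translationM z w : translation z -> translation w -> translation (z * w).
Proof.
move=> [s [t ->]] [s' [t' ->]]; exists (s ++ s'), (t' ++ t).
rewrite !cprod_cat invgM -!mulgA; congr (_ * _); rewrite !mulgA; congr (_ * _).
exact/commute_sym/commuteV/cprod_commute.
Qed.

Lemma translationV z : translation z -> translation z^-1.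
Proof. by move=> [s [t ->]]; exists t, s; rewrite invgM invgK. Qed.

Lemma translationJ g :
  (forall n m, translation (ccomm n m ^ g)) ->
  forall z, translation z -> translation (z ^ g).
Proof.
move=> Tg z [s [t ->]]; rewrite conjMg conjVg.
have Ts u : translation (cprod u ^ g).
  elim: u => [|p u IH]; first by rewrite /cprod big_nil conj1g; apply: translation1.
  by rewrite /cprod big_cons conjMg; apply: translationM.
by apply: translationM; last apply: translationV.
Qed.

Lemma translationJx z : translation z -> translation (z ^ x).
Proof.
by apply: translationJ => n m; rewrite ccomm_shiftx; apply: translation_ccomm.
Qed.

Lemma translationJxV z : translation z -> translation (z ^ x^-1).
Proof.
apply: translationJ => n m.
by rewrite -(subrK 1%R n) -ccomm_shiftx conjgK; apply: translation_ccomm.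
Qed.

Lemma translationJy z : translation z -> translation (z ^ y).
Proof.
by apply: translationJ => n m; rewrite ccomm_shifty; apply: translation_ccomm.
Qed.

Lemma translationJyV z : translation z -> translation (z ^ y^-1).
Proof.
apply: translationJ => n m.
by rewrite -(subrK 1%R m) -ccomm_shifty conjgK; apply: translation_ccomm.
Qed.

Lemma translation_kcomm m : translation (kcomm m).
Proof.
elim/int_shift_ind: m => [|m IH|m IH]; first by rewrite kcomm0; apply: translation1.
- by rewrite kcommS; apply: translationM => //; apply/translationV/translation_ccomm.
- have -> : kcomm m = ccomm 1 (m + 1)%R * kcomm (m + 1)%R by rewrite kcommS mulVKg.
  by apply: translationM => //; apply: translation_ccomm.
Qed.

Definition normal_form (g : G) : Prop :=
  exists a b s t, g = zexpg x a * (zexpg y b * (cprod s * (cprod t)^-1)).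

Lemma normal_form1 : normal_form 1.
Proof. by exists 0%R, 0%R, [::], [::]; rewrite !zexpg0 !mul1g mulgV. Qed.

Lemma normal_form_translation a b z :
  translation z -> normal_form (zexpg x a * (zexpg y b * z)).
Proof. by move=> [s [t ->]]; exists a, b, s, t. Qed.

(** Multiplication by [x] has to cross [y^b]; the price, [kcomm b], is a translation and joins the
    last factor. *)
Lemma normal_formMx g : normal_form g -> normal_form (g * x).
Proof.
move=> [a [b [s [t ->]]]]; set z := cprod s * _.
have -> : zexpg x a * (zexpg y b * z) * x =
    zexpg x (a + 1)%R * (zexpg y b * (kcomm b * z ^ x)).
  by rewrite zexpgS /kcomm conjgE -!mulgA !mulVKg.
apply: normal_form_translation; apply: translationM (translation_kcomm b) _.
by apply: translationJx; exists s, t.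
Qed.

Lemma normal_formMxV g : normal_form g -> normal_form (g * x^-1).
Proof.
move=> [a [b [s [t ->]]]]; set z := cprod s * _.
have -> : zexpg x a * (zexpg y b * z) * x^-1 =
    zexpg x (a - 1)%R * (zexpg y b * ((kcomm b)^-1 ^ x^-1 * z ^ x^-1)).
  rewrite zexpgP /kcomm !conjgE !invgM !invgK -!mulgA.
  by rewrite !(mulKg, mulVKg).
apply: normal_form_translation; apply: translationM.
  exact/translationJxV/translationV/translation_kcomm.
by apply: translationJxV; exists s, t.
Qed.

Lemma normal_formMy g : normal_form g -> normal_form (g * y).
Proof.
move=> [a [b [s [t ->]]]]; set z := cprod s * _.
have -> : zexpg x a * (zexpg y b * z) * y =
    zexpg x a * (zexpg y (b + 1)%R * z ^ y).
  by rewrite zexpgS conjgE -!mulgA mulVKg.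
by apply/normal_form_translation/translationJy; exists s, t.
Qed.

Lemma normal_formMyV g : normal_form g -> normal_form (g * y^-1).
Proof.
move=> [a [b [s [t ->]]]]; set z := cprod s * _.
have -> : zexpg x a * (zexpg y b * z) * y^-1 =
    zexpg x a * (zexpg y (b - 1)%R * z ^ y^-1).
  by rewrite zexpgP conjgE invgK -!mulgA mulKg.
by apply/normal_form_translation/translationJyV; exists s, t.
Qed.

End Metabelian.

(** * The presented group as a quotient of words *)

Lemma winv_cat u v : winv (u ++ v) = winv v ++ winv u.
Proof. by rewrite /winv map_cat rev_cat. Qed.

Lemma winvK : involutive winv.
Proof.
move=> w; rewrite /winv map_rev revK -map_comp -[RHS]map_id.
by apply: eq_map => -[b e] /=; rewrite negbK.
Qed.

Lemma pres_eq_ctx u v w1 w2 :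
  pres_eq w1 w2 -> pres_eq (u ++ w1 ++ v) (u ++ w2 ++ v).
Proof.
elim=> {w1 w2} [w|w1 w2 st|w1 w2 _ IH|w1 w2 w3 _ IH1 _ IH2].
- exact: pe_refl.
- apply: pe_step; case: st => [u' v' l|u' v' n m lp].
    have := step_free (u ++ u') (v' ++ v) l.
    by rewrite -!catA.
  have := step_rel (u ++ u') (v' ++ v) lp.
  by rewrite -!catA.
- exact: pe_sym.
- exact: pe_trans IH1 IH2.
Qed.

Lemma pres_eq_cat u1 u2 v1 v2 :
  pres_eq u1 u2 -> pres_eq v1 v2 -> pres_eq (u1 ++ v1) (u2 ++ v2).
Proof.
move=> /(pres_eq_ctx [::] v1) u12 /(pres_eq_ctx u2 [::]).
by rewrite !cats0; apply: pe_trans.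
Qed.

Lemma pres_eq_winvr w : pres_eq (w ++ winv w) [::].
Proof.
elim: w => [|l w IH]; first exact: pe_refl.
rewrite -cat1s winv_cat -catA (catA w); apply: pe_trans.
  exact: pres_eq_ctx IH.
exact: pe_step (step_free [::] [::] l).
Qed.

Lemma pres_eq_winvl w : pres_eq (winv w ++ w) [::].
Proof. by have := pres_eq_winvr (winv w); rewrite winvK. Qed.

(** Uniqueness of inverses: both sides equal [winv u ++ v ++ winv v]. *)
Lemma pres_eq_winv u v : pres_eq u v -> pres_eq (winv u) (winv v).
Proof.
move=> uv; have uVv : pres_eq (winv u ++ v ++ winv v) (winv v).
  have := pres_eq_ctx [::] (winv v) (pres_eq_winvl u).
  rewrite /= -catA; apply: pe_trans; apply: pres_eq_ctx; exact: pe_sym.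
apply: pe_trans uVv; apply: pe_sym.
have := pres_eq_ctx (winv u) [::] (pres_eq_winvr v).
by rewrite !cats0.
Qed.

(** The word equivalence is made boolean by classical logic, as the quotient type requires. *)
Definition pres_eqb (u v : seq letter) : bool := `[< pres_eq u v >].

Lemma pres_eqb_refl : reflexive pres_eqb.
Proof. by move=> w; apply/asboolP/pe_refl. Qed.

Lemma pres_eqb_sym u v : pres_eqb u v = pres_eqb v u.
Proof. by apply/asboolP/asboolP; apply: pe_sym. Qed.

Lemma pres_eqb_trans : transitive pres_eqb.
Proof.
move=> v u w /asboolP uv /asboolP vw; apply/asboolP; exact: pe_trans uv vw.
Qed.

Canonical pres_equiv :=
  EquivRel pres_eqb pres_eqb_refl pres_eqb_sym pres_eqb_trans.

Definition pres_group : Type := {eq_quot pres_equiv}%qT.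
HB.instance Definition _ := Choice.on pres_group.

Definition cls (w : seq letter) : pres_group := \pi_({eq_quot pres_equiv})%qT w.

Lemma cls_eqP u v : cls u = cls v <-> pres_eq u v.
Proof.
rewrite /cls; split=> [/eqP|uv]; first by rewrite eqmodE => /asboolP.
by apply/eqP; rewrite eqmodE; apply/asboolP.
Qed.

Lemma cls_surj (g : pres_group) : exists w, g = cls w.
Proof. by exists (repr (g : {eq_quot pres_equiv}%qT)); rewrite /cls reprK. Qed.

Definition pres_mul (g h : pres_group) : pres_group :=
  cls (repr (g : {eq_quot pres_equiv}%qT) ++ repr (h : {eq_quot pres_equiv}%qT)).
Definition pres_inv (g : pres_group) : pres_group :=
  cls (winv (repr (g : {eq_quot pres_equiv}%qT))).

Lemma repr_cls w : pres_eq (repr (cls w : {eq_quot pres_equiv}%qT)) w.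
Proof. by apply/cls_eqP; rewrite /cls reprK. Qed.

Lemma pres_mulE u v : pres_mul (cls u) (cls v) = cls (u ++ v).
Proof. by apply/cls_eqP/pres_eq_cat; apply: repr_cls. Qed.

Lemma pres_invE u : pres_inv (cls u) = cls (winv u).
Proof. by apply/cls_eqP/pres_eq_winv/repr_cls. Qed.

Lemma pres_mulA : associative pres_mul.
Proof.
move=> g h k; have [[u ->] [[v ->] [w ->]]] := (cls_surj g, (cls_surj h, cls_surj k)).
by rewrite !pres_mulE catA.
Qed.

Lemma pres_mul1 : left_id (cls [::]) pres_mul.
Proof. by move=> g; have [u ->] := cls_surj g; rewrite pres_mulE. Qed.

Lemma pres_mulr1 : right_id (cls [::]) pres_mul.
Proof. by move=> g; have [u ->] := cls_surj g; rewrite pres_mulE cats0. Qed.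

Lemma pres_mulV : left_inverse (cls [::]) pres_inv pres_mul.
Proof.
move=> g; have [u ->] := cls_surj g; rewrite pres_invE pres_mulE.
exact/cls_eqP/pres_eq_winvl.
Qed.

Lemma pres_mulrV : right_inverse (cls [::]) pres_inv pres_mul.
Proof.
move=> g; have [u ->] := cls_surj g; rewrite pres_invE pres_mulE.
exact/cls_eqP/pres_eq_winvr.
Qed.

HB.instance Definition _ := isGroup.Build pres_group
  pres_mulA pres_mul1 pres_mulr1 pres_mulV pres_mulrV.

Lemma clsM u v : cls (u ++ v) = (cls u * cls v)%g.
Proof. by rewrite -pres_mulE. Qed.

Lemma clsV u : cls (winv u) = (cls u)^-1%g.
Proof. by rewrite -pres_invE. Qed.

(** Shaped so that [relator n m] unfolds to [wcomm wc (wccomm n m)]. *)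
Definition wccomm (n m : int) : seq letter :=
  let g := wpow false n ++ wpow true m in winv g ++ wc ++ g.
Definition wprod (s : seq (int * int)) : seq letter :=
  flatten [seq wccomm p.1 p.2 | p <- s].

Lemma cls_nseq k l : cls (nseq k l) = (cls [:: l] ^+ k)%g.
Proof. by elim: k => [|k IH] //; rewrite expgS -IH -clsM. Qed.

Lemma cls_wpow b n : cls (wpow b n) = zexpg (cls [:: (b, false)]) n.
Proof.
by case: n => n /=; rewrite -?[_ :: nseq _ _]/(nseq n.+1 _) cls_nseq // -expVgn -clsV.
Qed.

Lemma cls_wc : cls wc =
  (cls y2 * (cls y3 * ((cls y2)^-1 * (cls y3)^-1)))%g.
Proof. by rewrite /wc /wcomm !clsM !clsV. Qed.

Lemma cls_wccomm n m : cls (wccomm n m) = ccomm (cls y2) (cls y3) n m.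
Proof.
rewrite /wccomm /ccomm conjgE -cls_wc !clsM clsV !clsM !cls_wpow.
by rewrite -!mulgA.
Qed.

Lemma cls_wprod s : cls (wprod s) = cprod (cls y2) (cls y3) s.
Proof.
rewrite /cprod; elim: s => [|p s IH]; first by rewrite big_nil.
by rewrite big_cons -IH -cls_wccomm -clsM.
Qed.

Lemma pres_group_rel n m : lex_pos n m ->
  commute (cls y2 * (cls y3 * ((cls y2)^-1 * (cls y3)^-1)))%g
    (ccomm (cls y2) (cls y3) n m).
Proof.
move=> lp; rewrite -cls_wc -cls_wccomm /commute.
apply/eqP; rewrite -divg_eq1 invgM mulgA; apply/eqP.
have /cls_eqP := pe_step (step_rel [::] [::] lp).
rewrite cat0s cats0 /relator -/(wccomm n m) {1}/wcomm.
by rewrite (clsM wc) (clsM (wccomm n m)) (clsM (winv wc)) !clsV !mulgA.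
Qed.

Lemma pres_eq_wprod s t : perm_eq s t -> pres_eq (wprod s) (wprod t).
Proof.
move=> st; apply/cls_eqP; rewrite !cls_wprod; apply: perm_cprod st.
exact: pres_group_rel.
Qed.

Lemma pres_eq_normal_form w : exists a b s t,
  pres_eq w (wpow false a ++ wpow true b ++ wprod s ++ winv (wprod t)).
Proof.
suff [a [b [s [t wE]]]] : normal_form (cls y2) (cls y3) (cls w).
  exists a, b, s, t; apply/cls_eqP.
  by rewrite !clsM clsV !cls_wprod !cls_wpow.
have rel := pres_group_rel.
elim/last_ind: w => [|w l IH]; first exact: normal_form1.
rewrite -cats1 clsM; case: l => -[] [].
- by rewrite -[[:: _]]/(winv y3) clsV; apply: normal_formMyV.
- exact: normal_formMy.
- by rewrite -[[:: _]]/(winv y2) clsV; apply: normal_formMxV.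
- exact: normal_formMx.
Qed.

(** * Algebraic independence of the two rotations *)

Section EnoughSquares.
Variable F : numFieldType.

(** The specialised rotations take only values [q^2] with [q > 1]. These are infinitely many, and
    [size a] distinct roots already force [a] to vanish. *)
Lemma poly_eq0_on_squares (a : {poly F}) :
  (forall q : nat, (1 < q)%N -> a.[(q ^ 2)%:R] = 0) -> a = 0.
Proof.
move=> az; pose rs := [seq ((k.+2 ^ 2)%:R : F) | k <- iota 0 (size a)].
apply: (@roots_geq_poly_eq0 _ a rs); last by rewrite size_map size_iota.
  by apply/allP => _ /mapP[k _ ->]; rewrite /root az.
rewrite map_inj_uniq ?iota_uniq // => i j /eqP.
by rewrite eqr_nat eqn_exp2r // => /eqP[].
Qed.

(** In characteristic zero a multiset of exponents is determined by its generating polynomial, whose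
    coefficients are the multiplicities. For fixed [p] the sum is the polynomial [A] in [q^2]; its
    coefficient at [i] is in turn the polynomial [B] in [p^2], whose coefficient at [j] counts
    [(i, j)]. *)
Lemma perm_eq_monomial_sums (s t : seq (nat * nat)) :
  (forall p q : nat, (1 < p)%N -> (1 < q)%N ->
    \sum_(z <- s) ((q ^ 2)%:R : F) ^+ z.1 * (p ^ 2)%:R ^+ z.2 =
    \sum_(z <- t) (q ^ 2)%:R ^+ z.1 * (p ^ 2)%:R ^+ z.2) ->
  perm_eq s t.
Proof.
move=> st; apply/allP => -[i j] _ /=; apply/eqP.
pose A (r : seq (nat * nat)) (p : nat) : {poly F} :=
  \sum_(z <- r) ((p ^ 2)%:R ^+ z.2) *: 'X^(z.1).
pose B (r : seq (nat * nat)) : {poly F} :=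
  \sum_(z <- r) (i == z.1)%:R *: 'X^(z.2).
have Aeq p : (1 < p)%N -> A s p = A t p.
  move=> p1; apply/eqP; rewrite -subr_eq0; apply/eqP.
  apply: poly_eq0_on_squares => q q1; rewrite !hornerE /A !horner_sum.
  apply/eqP; rewrite subr_eq0; apply/eqP.
  under eq_bigr do rewrite !hornerE mulrC.
  under [RHS]eq_bigr do rewrite !hornerE mulrC.
  exact: st.
have Beq : B s = B t.
  apply/eqP; rewrite -subr_eq0; apply/eqP.
  apply: poly_eq0_on_squares => p p1; rewrite !hornerE /B !horner_sum.
  have /(congr1 (fun a : {poly F} => a`_i)) := Aeq p p1.
  rewrite /A !coef_sum => e; apply/eqP; rewrite subr_eq0; apply/eqP.
  under eq_bigr do rewrite !hornerE mulrC -coefXn -coefZ.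
  by under [RHS]eq_bigr do rewrite !hornerE mulrC -coefXn -coefZ.
have cnt r : (B r)`_j = (count_mem (i, j) r)%:R.
  rewrite /B coef_sum -sum1_count natr_sum [RHS]big_mkcond.
  apply: eq_bigr => -[n m] _; rewrite coefZ coefXn /= -natrM mulnb.
  by rewrite -pair_eqE /= (eq_sym n) (eq_sym m); case: (_ && _).
by apply/eqP; rewrite -(eqr_nat F) -!cnt Beq.
Qed.

End EnoughSquares.

(** * Carrying a relation between the rotations to a specialisation *)

Section Specialisation.
Variables (A : comNzRingType) (n2 n3 d2 d3 : A).

(** With ['X] in the place of S, this is the sum of the [u2^i u3^j] for [u2 = (S - n2)^2 / d2] and
    [u3 = (S - n3)^2 / d3], multiplied by [(d2 d3)^N] to clear denominators. The truncated
    subtractions are exact once [N] bounds the exponents. *)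
Definition formal_sum (N : nat) (s : seq (nat * nat)) : {poly A} :=
  \sum_(z <- s)
    (('X - n2%:P) ^+ (2 * z.1) * d2%:P ^+ (N - z.1) *
     (('X - n3%:P) ^+ (2 * z.2) * d3%:P ^+ (N - z.2))).

Variables (K : fieldType) (f : {rmorphism A -> K}) (S : K).

(** The even and odd parts reduce [F] modulo [X^2 = D] to the form [e + o X]. Here [e] and [o]
    depend only on [F] and [D], so the same pair serves the true triangle and its
    specialisations. *)
Lemma horner_even_odd D F : S ^+ 2 = f D ->
  (map_poly f F).[S] = f (even_poly F).[D] + f (odd_poly F).[D] * S.
Proof.
move=> S2; rewrite -{1}[F]poly_even_odd rmorphD rmorphM /= !map_comp_poly.
rewrite map_polyXn map_polyX hornerD hornerM hornerX !horner_comp hornerXn S2.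
by rewrite !horner_map.
Qed.

Lemma horner_formal_sum N s : f d2 != 0 -> f d3 != 0 ->
  all (fun z => (z.1 <= N) && (z.2 <= N))%N s ->
  (map_poly f (formal_sum N s)).[S] =
    (f d2 * f d3) ^+ N * \sum_(z <- s)
      ((S - f n2) ^+ 2 / f d2) ^+ z.1 * ((S - f n3) ^+ 2 / f d3) ^+ z.2.
Proof.
move=> d20 d30 /allP sN; rewrite /formal_sum rmorph_sum horner_sum mulr_sumr.
apply: eq_big_seq => z /sN /andP[z1 z2].
rewrite !rmorphM /= !rmorphXn /= !rmorphB /= !map_polyX !map_polyC /=.
rewrite !(hornerE, horner_exp) !expr_div_n -!exprM exprMn.
have -> : f d2 ^+ N = f d2 ^+ (N - z.1) * f d2 ^+ z.1 by rewrite -exprD subnK.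
have -> : f d3 ^+ N = f d3 ^+ (N - z.2) * f d3 ^+ z.2 by rewrite -exprD subnK.
have : f d2 ^+ z.1 != 0 by rewrite expf_neq0.
have : f d3 ^+ z.2 != 0 by rewrite expf_neq0.
set q := f d3 ^+ z.2; set p := f d2 ^+ z.1 => q0 p0.
by rewrite /=; field; rewrite p0 q0.
Qed.

End Specialisation.

Local Notation mp3 := {mpoly rat[3]}.
Local Notation Xa := ('X_(inord 0) : mp3).
Local Notation Xb := ('X_(inord 1) : mp3).
Local Notation Xc := ('X_(inord 2) : mp3).

(** At the sides of a triangle the law of cosines gives [cos_num2 = 2 l1 l2 cos A3] and
    [cos_num3 = 2 l1 l3 cos A2]; the denominators are the squares of [2 l1 l2] and [2 l1 l3], and
    [heron] is [-16 Area^2], the square of S. *)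
Definition cos_num2 : mp3 := Xa ^+ 2 + Xb ^+ 2 - Xc ^+ 2.
Definition cos_num3 : mp3 := Xa ^+ 2 + Xc ^+ 2 - Xb ^+ 2.
Definition cos_den2 : mp3 := 4 * (Xa ^+ 2 * Xb ^+ 2).
Definition cos_den3 : mp3 := 4 * (Xa ^+ 2 * Xc ^+ 2).
Definition heron : mp3 := cos_num2 ^+ 2 - cos_den2.

Section TriangleSpecialisation.
Variables p q : nat.
Hypotheses (p1 : (1 < p)%N) (q1 : (1 < q)%N).

Let P : rat := p%:R.
Let Q : rat := q%:R.
Let a : rat := P * Q - (P * Q)^-1.
Let b : rat := P - P^-1.
Let c : rat := Q - Q^-1.
Definition spec_pt (i : 'I_3) : rat := [:: a; b; c]`_i.
Definition spec : {rmorphism mp3 -> rat} := mmap idfun spec_pt.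

Let subV_neq0 (r : rat) : 1 < r -> r - r^-1 != 0.
Proof.
move=> r1; rewrite subr_eq0; apply/negP => /eqP e.
have : r * r = 1 by rewrite {2}e divff // gt_eqF // (lt_trans ltr01).
by nra.
Qed.

Let P1 : 1 < P. Proof. by rewrite ltr1n. Qed.
Let Q1 : 1 < Q. Proof. by rewrite ltr1n. Qed.
Let PQ1 : 1 < P * Q. Proof. exact: mulr_egt1. Qed.

Lemma specE : [/\ spec Xa = a, spec Xb = b & spec Xc = c].
Proof.
by rewrite /spec /= !mmapX !mmap1U /spec_pt !inordK.
Qed.

(** Here [cos_num2] becomes [a b (Q + 1/Q)], and [(Q + 1/Q)^2 - 4 = c^2] is Heron's formula. With
    the minus sign in [S = - a b c], the difference [S - cos_num2] collapses to [- 2 a b Q] (the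
    other sign would give [1/Q]); likewise [S - cos_num3] is [- 2 a c P]. *)
Lemma spec_relations :
  [/\ (- (a * b * c)) ^+ 2 = spec heron, spec cos_den2 != 0,
    spec cos_den3 != 0, (- (a * b * c) - spec cos_num2) ^+ 2 / spec cos_den2 = Q ^+ 2
    & (- (a * b * c) - spec cos_num3) ^+ 2 / spec cos_den3 = P ^+ 2].
Proof.
have [ea eb ec] := specE.
have P0 : P != 0 by rewrite gt_eqF // (lt_trans ltr01).
have Q0 : Q != 0 by rewrite gt_eqF // (lt_trans ltr01).
have a0 : a != 0 by apply: subV_neq0.
have b0 : b != 0 by apply: subV_neq0.
have c0 : c != 0 by apply: subV_neq0.
have n2 : spec cos_num2 = a * b * (Q + Q^-1).
  rewrite /cos_num2 rmorphB rmorphD /= !rmorphXn /= ea eb ec /a /b /c.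
  by field; rewrite P0 Q0.
have n3 : spec cos_num3 = a * c * (P + P^-1).
  rewrite /cos_num3 rmorphB rmorphD /= !rmorphXn /= ea eb ec /a /b /c.
  by field; rewrite P0 Q0.
have d2 : spec cos_den2 = 4 * (a ^+ 2 * b ^+ 2).
  by rewrite /cos_den2 (rmorphM spec) rmorph_nat rmorphM !rmorphXn /= ea eb.
have d3 : spec cos_den3 = 4 * (a ^+ 2 * c ^+ 2).
  by rewrite /cos_den3 (rmorphM spec) rmorph_nat rmorphM !rmorphXn /= ea ec.
split.
- rewrite /heron rmorphB rmorphXn /= n2 d2 /c.
  by field; rewrite Q0.
- by rewrite d2 !mulf_neq0 ?expf_neq0.
- by rewrite d3 !mulf_neq0 ?expf_neq0.
- rewrite n2 d2.
  have -> : - (a * b * c) - a * b * (Q + Q^-1) = - (2 * a * b * Q) by rewrite /c; ring.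
  by field; rewrite a0 b0.
- rewrite n3 d3.
  have -> : - (a * b * c) - a * c * (P + P^-1) = - (2 * a * c * P) by rewrite /b; ring.
  by field; rewrite a0 c0.
Qed.

End TriangleSpecialisation.

(** A single specialisation with nonzero values is enough. *)
Lemma cos_den_neq0 : cos_den2 != 0 /\ cos_den3 != 0.
Proof.
have [_ d2 d3 _ _] := @spec_relations 2 2 isT isT.
by split; [apply: contraNneq d2 | apply: contraNneq d3] => ->; rewrite rmorph0.
Qed.

Section Independence.
Variables (K : fieldType) (f : {rmorphism mp3 -> K}) (S : K).
Hypothesis S2 : S ^+ 2 = f heron.
Hypothesis basis_1S : forall a b, f a + f b * S = 0 -> a = 0 /\ b = 0.

Let u2 := (S - f cos_num2) ^+ 2 / f cos_den2.
Let u3 := (S - f cos_num3) ^+ 2 / f cos_den3.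

Lemma indep_neq0 a : a != 0 -> f a != 0.
Proof.
apply: contraNneq => fa0; have := @basis_1S a 0.
by rewrite rmorph0 mul0r addr0 => /(_ fa0)[->].
Qed.

Lemma u_independent_nat (s t : seq (nat * nat)) :
  \sum_(z <- s) u2 ^+ z.1 * u3 ^+ z.2 = \sum_(z <- t) u2 ^+ z.1 * u3 ^+ z.2 ->
  perm_eq s t.
Proof.
move=> st; pose N := \max_(z <- s ++ t) maxn z.1 z.2.
have Nst : all (fun z => (z.1 <= N) && (z.2 <= N))%N (s ++ t).
  by apply/allP => z zst; rewrite -geq_max; apply: leq_bigmax_seq zst _.
move: Nst; rewrite all_cat => /andP[Ns Nt].
have [d2 d3] := cos_den_neq0.
pose FF := formal_sum cos_num2 cos_num3 cos_den2 cos_den3 N.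
(* The polynomial [FF s - FF t] vanishes at [S]. As 1 and [S] are independent over the image of [f],
   its reduction modulo [X^2 = heron] is already zero in Q[l1,l2,l3]. *)
have [e0 o0] : (even_poly (FF s - FF t)).[heron] = 0 /\
    (odd_poly (FF s - FF t)).[heron] = 0.
  apply: basis_1S; rewrite -horner_even_odd // rmorphB hornerD hornerN.
  by rewrite !horner_formal_sum ?indep_neq0 // st subrr.
apply: (@perm_eq_monomial_sums rat) => p q p1 q1.
have [h d2' d3' eu ev] := spec_relations p1 q1.
(* The zero reduction forces a zero at the specialised S as well, where [u2] and [u3] become [q^2]
   and [p^2]. *)
have := horner_even_odd (FF s - FF t) h.
rewrite e0 o0 !rmorph0 mul0r addr0 rmorphB hornerD hornerN => /eqP.
rewrite subr_eq0 !horner_formal_sum // eu ev => /eqP.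
rewrite -!natrX; apply: mulfI.
by rewrite expf_neq0 // mulf_neq0.
Qed.

Lemma u_neq0 : u2 != 0 /\ u3 != 0.
Proof.
split; apply/negP => /eqP z.
- have := @u_independent_nat [:: (1, 0)] [::].
  by rewrite big_seq1 big_nil z expr0n mul0r => /(_ erefl)/perm_size.
- have := @u_independent_nat [:: (0, 1)] [::].
  by rewrite big_seq1 big_nil z expr0n mulr0 => /(_ erefl)/perm_size.
Qed.

(** Multiplying by [(u2 u3)^N] makes all exponents nonnegative, so that [absz] in [up] loses nothing
    and [down] undoes it. *)
Lemma u_independent (s t : seq (int * int)) :
  \sum_(z <- s) u2 ^ z.1 * u3 ^ z.2 = \sum_(z <- t) u2 ^ z.1 * u3 ^ z.2 ->
  perm_eq s t.
Proof.
move=> st; have [u20 u30] := u_neq0.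
pose N := \max_(z <- s ++ t) maxn `|z.1| `|z.2|.
have Nst z : z \in s ++ t -> (0 <= z.1 + N%:Z) && (0 <= z.2 + N%:Z).
  move=> zst; have : (maxn `|z.1| `|z.2| <= N)%N by apply: leq_bigmax_seq zst _.
  by lia.
pose up (z : int * int) : nat * nat := (absz (z.1 + N%:Z), absz (z.2 + N%:Z)).
pose down (z : nat * nat) : int * int := (z.1%:Z - N%:Z, z.2%:Z - N%:Z).
have upK r : {subset r <= s ++ t} -> r = map down (map up r).
  move=> rst; rewrite -map_comp -[LHS]map_id; apply/eq_in_map => -[n m] /rst /Nst.
  by rewrite /= /down /up /= => /andP[n0 m0]; congr pair; lia.
have sumE r : {subset r <= s ++ t} ->
    \sum_(z <- map up r) u2 ^+ z.1 * u3 ^+ z.2 =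
    (u2 ^+ N * u3 ^+ N) * \sum_(z <- r) u2 ^ z.1 * u3 ^ z.2.
  move=> rst; rewrite big_map mulr_sumr; apply: eq_big_seq => z /rst /Nst /andP[n0 m0].
  rewrite /= !exprnP !gez0_abs // !expfzDr //; ring.
have sst : {subset s <= s ++ t} by move=> z zs; rewrite mem_cat zs.
have tst : {subset t <= s ++ t} by move=> z zt; rewrite mem_cat zt orbT.
rewrite (upK s) // (upK t) //; apply/perm_map/u_independent_nat.
by rewrite !sumE // st.
Qed.

End Independence.

(** * Rigid motions as complex affine maps *)

Local Open Scope complex_scope.

Section ComplexPlane.
Variable R : realType.
Implicit Types (v d P Q : 'rV[R]_2) (z u b c : R[i]) (g h : aff R).

Definition cplx v : R[i] := v 0 0 +i* v 0 1.
Arguments cplx : simpl never.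
Definition vec z : 'rV[R]_2 := \row_j (if j == 0 then complex.Re z else complex.Im z).
(** Matrices act on row vectors from the right, so the rows are the images of 1 and ['i] under
    multiplication by [u]. *)
Definition rotmx u : 'M[R]_2 := \matrix_(i < 2) vec (if i == 0 then u else 'i * u).

Lemma vecK : cancel vec cplx.
Proof. by case=> x y; rewrite /cplx !mxE. Qed.

Lemma ord2P (j : 'I_2) : j = 0 \/ j = 1.
Proof. by case: j => -[|[|//]] ?; [left | right]; apply/val_inj. Qed.

Lemma lift01 : lift ord0 ord0 = 1 :> 'I_2.
Proof. exact/val_inj. Qed.

Lemma cplxK : cancel cplx vec.
Proof. by move=> v; apply/rowP => j; rewrite !mxE; case: (ord2P j) => ->. Qed.

Lemma cplx_inj : injective cplx. Proof. exact: can_inj cplxK. Qed.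

Lemma cplxD v w : cplx (v + w) = cplx v + cplx w.
Proof. by rewrite /cplx !mxE. Qed.

Lemma cplxN v : cplx (- v) = - cplx v.
Proof. by rewrite /cplx !mxE. Qed.

Lemma cplxB v w : cplx (v - w) = cplx v - cplx w.
Proof. by rewrite cplxD cplxN. Qed.

Lemma cplx0 : cplx 0 = 0.
Proof. by rewrite /cplx !mxE. Qed.

Lemma cplxZ (k : R) v : cplx (k *: v) = k%:C * cplx v.
Proof. by rewrite /cplx !mxE; simpc. Qed.

Lemma cplx_rot v u : cplx (v *m rotmx u) = cplx v * u.
Proof.
case: u => x y; rewrite /cplx !mxE !big_ord_recl !big_ord0 !mxE /= !addr0.
rewrite lift01.
by simpc; congr (_ +i* _); ring.
Qed.

Lemma rotmx_eq (M : 'M[R]_2) u :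
  (forall v, cplx (v *m M) = cplx v * u) -> M = rotmx u.
Proof.
move=> Mu; apply/row_matrixP => i; rewrite !rowE; apply: cplx_inj.
by rewrite cplx_rot Mu.
Qed.

Lemma rotmx1 : rotmx 1 = 1%:M.
Proof. by apply/esym/rotmx_eq => v; rewrite mulmx1 mulr1. Qed.

Lemma rotmxM u z : rotmx u *m rotmx z = rotmx (u * z).
Proof. by apply: rotmx_eq => v; rewrite mulmxA !cplx_rot mulrA. Qed.

Lemma rotmxV u : u != 0 -> invmx (rotmx u) = rotmx u^-1.
Proof.
move=> u0; have uV : rotmx u *m rotmx u^-1 = 1%:M by rewrite rotmxM divff ?rotmx1.
have [uu _] := mulmx1_unit uV.
by rewrite -[RHS](mulKmx uu) uV mulmx1.
Qed.

Lemma rotmx_inj : injective rotmx.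
Proof.
move=> u z uz; rewrite -[u]mul1r -[z]mul1r -(vecK 1) -!cplx_rot.
by rewrite uz.
Qed.

(** In the complex coordinate this is the map [z |-> z u + b]. *)
Definition rigid u b : aff R := (rotmx u, vec b).

Lemma rigidP g u b : (forall v, cplx (v *m g.1) = cplx v * u) ->
  cplx g.2 = b -> g = rigid u b.
Proof.
by case: g => M w /= /rotmx_eq -> <-; rewrite /rigid cplxK.
Qed.

Lemma rigid_inj u b z c : rigid u b = rigid z c -> u = z /\ b = c.
Proof. by case=> /rotmx_inj -> /(can_inj vecK). Qed.

Lemma rigid1 : aone R = rigid 1 0.
Proof.
by apply: rigidP => [v|] /=; [rewrite mulmx1 mulr1 | rewrite cplx0].
Qed.

Lemma amul_rigid u b z c : amul (rigid u b) (rigid z c) = rigid (u * z) (b * z + c).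
Proof.
apply: rigidP => [v|] /=; first by rewrite mulmxA !cplx_rot mulrA.
by rewrite cplxD cplx_rot !vecK.
Qed.

Lemma ainv_rigid u b : u != 0 -> ainv (rigid u b) = rigid u^-1 (- (b / u)).
Proof.
move=> u0; apply: rigidP => [v|] /=; rewrite rotmxV //; first by rewrite cplx_rot.
by rewrite cplxN cplx_rot vecK.
Qed.

Lemma amulA : associative (@amul R).
Proof. by move=> g h k; rewrite /amul /= mulmxA mulmxDl mulmxA addrA. Qed.

Lemma amul1 g : amul (aone R) g = g.
Proof. by case: g => M w; rewrite /amul /= mul1mx mul0mx add0r. Qed.

Lemma amulr1 g : amul g (aone R) = g.
Proof. by case: g => M w; rewrite /amul /= !mulmx1 addr0. Qed.

Lemma dot_cplx v d :
  (dot v d)%:C * 2 = cplx v * (cplx d)^* + (cplx v)^* * cplx d.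
Proof.
rewrite /dot /cplx !mxE !big_ord_recl big_ord0 !mxE /= !addr0.
rewrite lift01.
by rewrite mulr_natr mulr2n; simpc; congr (_ +i* _); ring.
Qed.

Lemma dot_sqr d : (dot d d)%:C = cplx d * (cplx d)^*.
Proof.
have := dot_cplx d d; rewrite [X in _ + X]mulrC -mulr2n -[in RHS]mulr_natr.
by apply: mulIf; rewrite pnatr_eq0.
Qed.

Lemma cplx_eq0 d : (cplx d == 0) = (d == 0).
Proof. by rewrite -(inj_eq cplx_inj) cplx0. Qed.

Lemma cplx_refl P Q v : Q - P != 0 ->
  cplx (v *m reflM P Q) = cplx (Q - P) / (cplx (Q - P))^* * (cplx v)^*.
Proof.
rewrite /reflM; set d := Q - P => d0.
have c0 : cplx d != 0 by rewrite cplx_eq0.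
have cJ0 : (cplx d)^* != 0 by rewrite conjc_eq0.
have vd : v *m (d^T *m d) = dot v d *: d.
  by rewrite mulmxA [v *m d^T]mx11_scalar mul_scalar_mx.
have vdC : (dot v d)%:C = (cplx v * (cplx d)^* + (cplx v)^* * cplx d) / 2.
  by rewrite -dot_cplx mulfK // pnatr_eq0.
rewrite mulmxBr mulmx1 -scalemxAr vd cplxB !cplxZ !(rmorphM, fmorphV) /= dot_sqr.
rewrite rmorph_nat vdC.
by field; rewrite c0 cJ0.
Qed.

Lemma conjc_reflect (a b z : R[i]) : (a / b^* * z^*)^* = a^* / b * z.
Proof. by rewrite !rmorphM fmorphV; congr (_ / _ * _); apply: conjcK. Qed.

Lemma refl_mulK P Q : Q - P != 0 -> amul (refl P Q) (refl P Q) = aone R.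
Proof.
move=> d0; rewrite rigid1; have MM : reflM P Q *m reflM P Q = 1%:M.
  rewrite -rotmx1; apply: rotmx_eq => v; rewrite mulmxA !cplx_refl //.
  rewrite [X in _ * X]conjc_reflect.
  have c0 : cplx (Q - P) != 0 by rewrite cplx_eq0.
  have cJ0 : (cplx (Q - P))^* != 0 by rewrite conjc_eq0.
  by field; rewrite c0 cJ0.
apply: rigidP => [v|] /=; first by rewrite MM mulmx1 mulr1.
by rewrite mulmxBl -mulmxA MM mulmx1 addrA subrK subrr cplx0.
Qed.

Lemma refl_fixl P Q : P *m reflM P Q + (refl P Q).2 = P.
Proof. by rewrite /refl /= addrCA subrr addr0. Qed.

Lemma refl_fixr P Q : Q - P != 0 -> Q *m reflM P Q + (refl P Q).2 = Q.
Proof.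
move=> d0; rewrite /refl /= addrCA -mulmxBl addrC.
have -> : (Q - P) *m reflM P Q = Q - P; last by rewrite subrK.
by apply: cplx_inj; rewrite cplx_refl // divfK // conjc_eq0 cplx_eq0.
Qed.

Lemma det2 (M : 'M[R]_2) : \det M = M 0 0 * M 1 1 - M 0 1 * M 1 0.
Proof.
rewrite (expand_det_row _ 0) !big_ord_recl big_ord0 /cofactor !det_mx11 !mxE /=.
rewrite /bump /= addr0 add0n expr0 expr1 mul1r mulN1r mulrN.
by congr (M _ _ * M _ _ - M _ _ * M _ _); apply/val_inj.
Qed.

Lemma det_reflM P Q : Q - P != 0 -> \det (reflM P Q) = -1.
Proof.
rewrite /reflM; move: (Q - P) => d d0.
have dd0 : dot d d != 0.
  by rewrite -(inj_eq (@complexI R)) dot_sqr mulf_neq0 ?conjc_eq0 ?cplx_eq0.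
have dE : dot d d = d 0 0 ^+ 2 + d 0 1 ^+ 2.
  rewrite /dot !mxE !big_ord_recl big_ord0 !mxE addr0.
  by rewrite lift01 !expr2.
rewrite det2 !mxE !big_ord_recl !big_ord0 !mxE /= !addr0.
by rewrite dE in dd0 *; field.
Qed.

End ComplexPlane.

(** * Evaluation of words and its kernel *)

Lemma weval_cat (R : realType) (g2 g3 : aff R) w1 w2 :
  weval g2 g3 (w1 ++ w2) = amul (weval g2 g3 w1) (weval g2 g3 w2).
Proof.
elim: w1 => [|l w1 IH]; first by rewrite amul1.
by rewrite [LHS]/weval /= -/(weval _ _ _) IH amulA.
Qed.

Section WordEvaluation.
Variables (R : realType) (u2 u3 b2 b3 : R[i]).
Hypotheses (u2_neq0 : u2 != 0) (u3_neq0 : u3 != 0).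

Let g2 := rigid u2 b2.
Let g3 := rigid u3 b3.
Local Notation ev := (weval g2 g3).

Lemma weval1E b e : ev [:: (b, e)] =
  let g := if b then g3 else g2 in if e then ainv g else g.
Proof. by rewrite /weval /= amulr1. Qed.

Lemma weval_rigid w : exists z d, z != 0 /\ ev w = rigid z d.
Proof.
elim: w => [|[b e] w [z [d [z0 ew]]]].
  by exists 1, 0; rewrite -rigid1; split; first exact: oner_neq0.
rewrite -cat1s weval_cat ew weval1E.
have [z' [d' [z'0 ->]]] : exists z' d', z' != 0 /\
    (let g := if b then g3 else g2 in if e then ainv g else g) = rigid z' d'.
  case: b e => -[] /=; rewrite /g2 /g3 ?ainv_rigid //;
    eexists; eexists; split; try reflexivity; by rewrite ?invr_eq0.
by rewrite amul_rigid; eexists; eexists; split; [|reflexivity]; rewrite mulf_neq0.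
Qed.

Lemma ainvK_rigid (z d : R[i]) : z != 0 -> ainv (ainv (rigid z d)) = rigid z d.
Proof.
by move=> z0; rewrite !ainv_rigid ?invr_eq0 // !invrK; congr rigid; field.
Qed.

Lemma ainvM_rigid (z d z' d' : R[i]) : z != 0 -> z' != 0 ->
  ainv (amul (rigid z d) (rigid z' d')) =
  amul (ainv (rigid z' d')) (ainv (rigid z d)).
Proof.
move=> z0 z'0; rewrite amul_rigid !ainv_rigid ?mulf_neq0 // amul_rigid.
by congr rigid; field; rewrite z0 z'0.
Qed.

Lemma weval_winv w : ev (winv w) = ainv (ev w).
Proof.
elim: w => [|[b e] w IH].
  by rewrite /= rigid1 ainv_rigid ?oner_neq0 // invr1 mul0r oppr0.
rewrite -cat1s winv_cat !weval_cat IH.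
have [z [d [z0 ew]]] := weval_rigid w.
have [z' [d' [z'0 el]]] := weval_rigid [:: (b, e)].
rewrite ew el ainvM_rigid //; congr amul; rewrite -el.
rewrite -[winv _]/[:: (b, ~~ e)] !weval1E.
by case: b e {el} => -[] //=; rewrite ainvK_rigid.
Qed.

(** The translation part stays unspecified, because conjugating a translation by the power depends
    only on its linear part. *)
Lemma weval_nseq k b : exists d, ev (nseq k (b, false)) =
  rigid ((if b then u3 else u2) ^+ k) d.
Proof.
elim: k => [|k [d IH]]; first by exists 0; rewrite expr0 -rigid1.
rewrite -[nseq k.+1 _]/([:: (b, false)] ++ nseq k (b, false)) weval_cat IH weval1E.
by case: b {IH}; rewrite /= amul_rigid exprS; eexists.
Qed.

Lemma winv_nseq k b e : winv (nseq k (b, e)) = nseq k (b, ~~ e).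
Proof.
rewrite /winv map_nseq; apply: (@eq_from_nth _ (b, e)).
  by rewrite size_rev.
move=> i; rewrite size_rev size_nseq => ik.
by rewrite nth_rev size_nseq // !nth_nseq ik ltn_subrL (leq_ltn_trans _ ik).
Qed.

Lemma weval_wpow b n : exists d, ev (wpow b n) =
  rigid ((if b then u3 else u2) ^ n) d.
Proof.
case: n => k; first exact: weval_nseq.
rewrite /wpow -[true]/(~~ false) -winv_nseq weval_winv.
have [d ->] := weval_nseq k.+1 b.
rewrite ainv_rigid; first by eexists.
by rewrite expf_neq0 //; case: b.
Qed.

Let tau := (b2 * (u3 - 1) + b3 * (1 - u2)) / (u2 * u3).

Lemma weval_wc : ev wc = rigid 1 tau.
Proof.
rewrite /wc /wcomm !weval_cat !weval_winv !weval1E /= !ainv_rigid // !amul_rigid.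
by congr rigid; [field | rewrite /tau; field]; rewrite u2_neq0 u3_neq0.
Qed.

(** Conjugating a translation by a rigid map multiplies its vector by the linear part of that
    map. *)
Lemma weval_wccomm n m : ev (wccomm n m) = rigid 1 (tau * (u2 ^ n * u3 ^ m)).
Proof.
rewrite /wccomm weval_cat weval_winv (weval_cat _ _ wc) weval_wc weval_cat.
have [d ->] := weval_wpow false n; have [d' ->] := weval_wpow true m.
have n0 : u2 ^ n != 0 by rewrite expfz_neq0.
have m0 : u3 ^ m != 0 by rewrite expfz_neq0.
rewrite amul_rigid ainv_rigid ?mulf_neq0 // !amul_rigid.
by congr rigid; field; rewrite n0 m0.
Qed.

Lemma weval_wprod s :
  ev (wprod s) = rigid 1 (tau * \sum_(z <- s) u2 ^ z.1 * u3 ^ z.2).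
Proof.
elim: s => [|z s IH]; first by rewrite big_nil mulr0 -rigid1.
rewrite [wprod _]/(wccomm z.1 z.2 ++ wprod s) weval_cat IH weval_wccomm.
by rewrite amul_rigid big_cons; congr rigid; ring.
Qed.

Lemma weval_relator n m : ev (relator n m) = aone R.
Proof.
rewrite /relator -/(wccomm n m) {1}/wcomm (weval_cat _ _ wc).
rewrite (weval_cat _ _ (wccomm n m)) (weval_cat _ _ (winv wc)) !weval_winv.
rewrite weval_wccomm weval_wc !ainv_rigid ?oner_neq0 // !amul_rigid rigid1.
by congr rigid; field.
Qed.

Lemma weval_pres_eq w1 w2 : pres_eq w1 w2 -> ev w1 = ev w2.
Proof.
elim=> {w1 w2} [//|w1 w2 st|//|w1 w2 w3 _ -> _ ->//].
case: st => [u v l|u v n m _].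
  rewrite weval_cat (weval_cat _ _ [:: _; _]) weval_cat; congr amul.
  rewrite -[RHS]amul1; congr amul; rewrite -cat1s weval_cat.
  rewrite -[[:: (l.1, _)]]/(winv [:: l]) weval_winv.
  have [z [d [z0 ->]]] := weval_rigid [:: l].
  rewrite ainv_rigid // amul_rigid rigid1.
  by congr rigid; field.
by rewrite !(weval_cat _ _ u) (weval_cat _ _ (relator n m)) weval_relator amul1.
Qed.

Hypothesis independent : forall s t : seq (int * int),
  \sum_(z <- s) u2 ^ z.1 * u3 ^ z.2 = \sum_(z <- t) u2 ^ z.1 * u3 ^ z.2 ->
  perm_eq s t.
Hypothesis tau_neq0 : tau != 0.

(** The linear part of the normal form is [u2^a u3^b], and independence on one-term sums forces
    [a = b = 0]. What remains is a translation by [tau] times the difference of the sums over [s]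
    and [t]; its vanishing makes [s] a permutation of [t]. *)
Lemma weval_kernel w : ev w = aone R <-> pres_eq w [::].
Proof.
split=> [ew1|/weval_pres_eq-> //].
have [a [b [s [t nf]]]] := pres_eq_normal_form w.
move: (weval_pres_eq nf); rewrite ew1 (weval_cat _ _ (wpow false a)).
rewrite (weval_cat _ _ (wpow true b)) (weval_cat _ _ (wprod s)) weval_winv.
rewrite !weval_wprod.
rewrite ainv_rigid ?oner_neq0 // amul_rigid.
have [d2 e2] := weval_wpow false a; have [d3 e3] := weval_wpow true b.
rewrite e2 e3 !amul_rigid rigid1 => /rigid_inj[lin tr].
have /perm_mem /(_ (a, b)) : perm_eq [:: (a, b)] [:: (0, 0)].
  by apply: independent; rewrite !big_seq1 !expr0z mulr1 lin; field.
rewrite !inE eqxx => /esym /eqP[a0 b0].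
(* Both powers are now the empty word, so [d2] and [d3] are zero and drop out of the translation
   part. *)
move: tr nf e2 e3; rewrite {}a0 {}b0 /= => tr nf.
rewrite !rigid1 => /rigid_inj[_ d20] /rigid_inj[_ d30].
have st : perm_eq s t.
  apply: independent; apply: (mulfI tau_neq0); apply/eqP; rewrite -subr_eq0.
  by apply/eqP; rewrite [RHS]tr -d20 -d30; field.
apply: pe_trans nf _; apply: pe_trans (pres_eq_winvr (wprod t)).
by apply: pres_eq_cat (pe_refl _); apply: pres_eq_wprod.
Qed.

End WordEvaluation.

(** * Products of two reflections in the sides of a triangle *)

Section TriangleGeometry.
Variable R : realType.
Implicit Types (v d e P Q X : 'rV[R]_2).

Definition cross d e : R := d 0 0 * e 0 1 - d 0 1 * e 0 0.

Lemma dotE d e : dot d e = d 0 0 * e 0 0 + d 0 1 * e 0 1.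
Proof. by rewrite /dot !mxE !big_ord_recl big_ord0 !mxE addr0 lift01. Qed.

Lemma cplx_mul_conj d e : cplx d * (cplx e)^* = dot d e +i* cross e d.
Proof. by rewrite dotE /cross /cplx; simpc; congr (_ +i* _); ring. Qed.

(** For nonzero [d] and [e], the unit complex number whose argument is twice the angle from [d] to
    [e]: the linear part of a reflection along [d] followed by one along [e]. *)
Definition reflect_quot d e : R[i] :=
  cplx e / (cplx e)^* * ((cplx d)^* / cplx d).

Lemma reflect_quotE d e : d != 0 -> e != 0 ->
  reflect_quot d e = (dot e d +i* cross d e) ^+ 2 / (dot e e * dot d d)%:C.
Proof.
rewrite -!cplx_eq0 => d0 e0; rewrite -cplx_mul_conj rmorphM /= !dot_sqr /reflect_quot.
have dJ0 : (cplx d)^* != 0 by rewrite conjc_eq0.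
have eJ0 : (cplx e)^* != 0 by rewrite conjc_eq0.
by field; rewrite d0 e0 dJ0 eJ0.
Qed.

(** The product of the linear parts is multiplication by [u]; the common fixed point [X] then
    determines the translation part, from [X u + b = X]. *)
Lemma amul_refl P Q P' Q' X : Q - P != 0 -> Q' - P' != 0 ->
  X *m reflM P Q + (refl P Q).2 = X -> X *m reflM P' Q' + (refl P' Q').2 = X ->
  let u := reflect_quot (Q - P) (Q' - P') in
  amul (refl P Q) (refl P' Q') = rigid u (cplx X * (1 - u)).
Proof.
move=> d0 e0 X1 X2 u; have rot v : cplx (v *m (reflM P Q *m reflM P' Q')) = cplx v * u.
  by rewrite mulmxA !cplx_refl // [X in _ * X]conjc_reflect /u /reflect_quot; ring.
apply: rigidP => //=.
have fixX : X *m (reflM P Q *m reflM P' Q') +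
    ((refl P Q).2 *m reflM P' Q' + (refl P' Q').2) = X.
  by rewrite mulmxA addrA -mulmxDl X1 X2.
have := congr1 (@cplx R) fixX; rewrite cplxD rot => /(canRL (addKr _)) ->.
by ring.
Qed.

Lemma amul_ainv_rigid (z b : R[i]) : z != 0 ->
  amul (rigid z b) (ainv (rigid z b)) = aone R.
Proof.
by move=> z0; rewrite ainv_rigid // amul_rigid rigid1; congr rigid; field.
Qed.

End TriangleGeometry.

Section GenericTriangle.
Variables (R : realType) (A1 A2 A3 : 'rV[R]_2).
Hypotheses (triangle : is_triangle A1 A2 A3) (generic : generic_triangle A1 A2 A3).

Let f1 := A3 - A2.
Let f2 := A1 - A3.
Let f3 := A2 - A1.
(** Minus twice the signed area of the triangle. *)
Let kappa := cross f2 f1.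

Lemma kappa_neq0 : kappa != 0.
Proof.
have up j : col_mx (A2 - A1) (A3 - A1) 0 j = (A2 - A1) 0 j.
  by rewrite mxE; case: splitP => i //; rewrite ord1.
have down j : col_mx (A2 - A1) (A3 - A1) 1 j = (A3 - A1) 0 j.
  by rewrite mxE; case: splitP => i //; rewrite ord1.
move: triangle; rewrite /is_triangle det2 !up !down; apply: contraNneq => k0.
by rewrite -oppr_eq0 -[X in _ == X]k0 /kappa /cross /f1 /f2 !mxE; apply/eqP; ring.
Qed.

(** The edges satisfy [f1 + f2 + f3 = 0], so both cross products give the same area. This lets a
    single S serve [u2] and [u3]. *)
Lemma cross13 : cross f1 f3 = kappa.
Proof. by rewrite /kappa /cross /f1 /f2 /f3 !mxE; ring. Qed.

Lemma edge1_neq0 : f1 != 0.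
Proof.
by apply: contraNneq kappa_neq0 => z; rewrite /kappa /cross z !mxE !mulr0 subrr.
Qed.

Lemma edge2_neq0 : f2 != 0.
Proof.
by apply: contraNneq kappa_neq0 => z; rewrite /kappa /cross z !mxE !mul0r subrr.
Qed.

Lemma edge3_neq0 : f3 != 0.
Proof.
by apply: contraNneq kappa_neq0 => z; rewrite -cross13 /cross z !mxE !mulr0 subrr.
Qed.

Let u2 := reflect_quot f2 f1.
Let u3 := reflect_quot f1 f3.

Lemma angles_independent (s t : seq (int * int)) :
  \sum_(z <- s) u2 ^ z.1 * u3 ^ z.2 = \sum_(z <- t) u2 ^ z.1 * u3 ^ z.2 ->
  perm_eq s t.
Proof.
have [k [k0 indep]] := generic.
set pt := (fun i : 'I_3 => _) in indep.
pose ev : {rmorphism mp3 -> R} := mmap (@ratr R) pt.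
pose f : {rmorphism mp3 -> R[i]} := real_complex R \o ev.
(* This is [4 i Area] of the triangle scaled by [k], up to the sign given by the orientation. *)
pose S : R[i] := 0 +i* (2 * k ^+ 2 * kappa).
have k2 : k ^+ 2 != 0 by rewrite expf_neq0 // gt_eqF.
have s0 : 2 * k ^+ 2 * kappa != 0.
  by rewrite mulf_neq0 ?kappa_neq0 // mulf_neq0 ?pnatr_eq0.
have ev_inj a : ev a = 0 -> a = 0.
  by move=> /eqP ea; apply/eqP; apply: contraTT ea; apply: indep.
have dist2 P Q : (k * dist P Q) ^+ 2 = k ^+ 2 * dot (Q - P) (Q - P).
  by rewrite exprMn sqr_sqrtr // dotE -!expr2 addr_ge0 ?sqr_ge0.
have ea : ev Xa ^+ 2 = k ^+ 2 * dot f1 f1.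
  by rewrite /ev /= mmapX mmap1U /pt inordK //= dist2.
have eb : ev Xb ^+ 2 = k ^+ 2 * dot f2 f2.
  by rewrite /ev /= mmapX mmap1U /pt inordK //= dist2.
have ec : ev Xc ^+ 2 = k ^+ 2 * dot f3 f3.
  by rewrite /ev /= mmapX mmap1U /pt inordK //= dist2.
(* The minus sign arises because consecutive edges run head to tail: the angle at [A3] lies between
   [f1] and [- f2]. *)
have n2 : ev cos_num2 = - (2 * k ^+ 2 * dot f1 f2).
  rewrite /cos_num2 rmorphB rmorphD /= !rmorphXn /= ea eb ec.
  by rewrite !dotE /f1 /f2 /f3 !mxE; ring.
have n3 : ev cos_num3 = - (2 * k ^+ 2 * dot f3 f1).
  rewrite /cos_num3 rmorphB rmorphD /= !rmorphXn /= ea eb ec.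
  by rewrite !dotE /f1 /f2 /f3 !mxE; ring.
have d2 : ev cos_den2 = 4 * k ^+ 4 * (dot f1 f1 * dot f2 f2).
  by rewrite /cos_den2 (rmorphM ev) rmorph_nat rmorphM !rmorphXn /= ea eb; ring.
have d3 : ev cos_den3 = 4 * k ^+ 4 * (dot f3 f3 * dot f1 f1).
  by rewrite /cos_den3 (rmorphM ev) rmorph_nat rmorphM !rmorphXn /= ea ec; ring.
have S2 : S ^+ 2 = f heron.
  have -> : f heron = (ev heron)%:C by [].
  rewrite /heron rmorphB rmorphXn /= n2 d2 expr2 /S; simpc.
  by congr (_ +i* _); rewrite /kappa /cross !dotE; ring.
(* The values of [f] are real and [S] is purely imaginary and nonzero, so both coefficients evaluate
   to zero; genericity makes evaluation injective. *)
have basis a b : f a + f b * S = 0 -> a = 0 /\ b = 0.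
  have -> : f a = (ev a)%:C by [].
  have -> : f b = (ev b)%:C by [].
  rewrite /S; simpc => -[/ev_inj a0 /eqP].
  rewrite mulf_eq0 (negbTE s0) orbF => /eqP.
  by move/ev_inj.
have e2 : u2 = (S - f cos_num2) ^+ 2 / f cos_den2.
  have -> : S - f cos_num2 = (2 * k ^+ 2)%:C * (dot f1 f2 +i* kappa).
    have -> : f cos_num2 = (ev cos_num2)%:C by [].
    by rewrite n2 /S; simpc; congr (_ +i* _); ring.
  have -> : f cos_den2 = (2 * k ^+ 2)%:C ^+ 2 * (dot f1 f1 * dot f2 f2)%:C.
    have -> : f cos_den2 = (ev cos_den2)%:C by [].
    by rewrite d2 -rmorphXn -rmorphM /=; congr (_%:C); ring.
  rewrite /u2 reflect_quotE ?edge1_neq0 ?edge2_neq0 // exprMn -/kappa.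
  by rewrite -mulf_div divff ?mul1r // expf_neq0 // -(rmorph0 (real_complex R))
    (inj_eq (@complexI R)) mulf_neq0 // pnatr_eq0.
have e3 : u3 = (S - f cos_num3) ^+ 2 / f cos_den3.
  have -> : S - f cos_num3 = (2 * k ^+ 2)%:C * (dot f3 f1 +i* kappa).
    have -> : f cos_num3 = (ev cos_num3)%:C by [].
    by rewrite n3 /S; simpc; congr (_ +i* _); ring.
  have -> : f cos_den3 = (2 * k ^+ 2)%:C ^+ 2 * (dot f3 f3 * dot f1 f1)%:C.
    have -> : f cos_den3 = (ev cos_den3)%:C by [].
    by rewrite d3 -rmorphXn -rmorphM /=; congr (_%:C); ring.
  rewrite /u3 reflect_quotE ?edge1_neq0 ?edge3_neq0 // exprMn cross13.
  by rewrite -mulf_div divff ?mul1r // expf_neq0 // -(rmorph0 (real_complex R))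
    (inj_eq (@complexI R)) mulf_neq0 // pnatr_eq0.
rewrite e2 e3; exact: (u_independent S2 basis).
Qed.

End GenericTriangle.

(** * Orientation-preserving elements as words in the two rotations *)

Section InvolutionPairs.
Variables (R : realType) (a b c : aff R).
Hypotheses (aa : amul a a = aone R) (bb : amul b b = aone R) (cc : amul c c = aone R).
Hypothesis baV : amul (amul b a) (ainv (amul b a)) = aone R.
Hypothesis acV : amul (amul a c) (ainv (amul a c)) = aone R.

Lemma ainv_uniq (g h : aff R) :
  amul h g = aone R -> amul g (ainv g) = aone R -> ainv g = h.
Proof. by move=> hg gV; rewrite -[LHS]amul1 -hg -amulA gV amulr1. Qed.

(** Every product passes through [a], as [g h = (g a) (a h)], and the factors [b a], [a c], [a b],
    [c a] are the two rotations and their inverses. *)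
Lemma involution_pair_word : forall g h : aff R,
  [\/ g = a, g = b | g = c] -> [\/ h = a, h = b | h = c] ->
  exists w, weval (amul b a) (amul a c) w = amul g h.
Proof.
have mid (x y z : aff R) : amul y y = aone R -> amul (amul x y) (amul y z) = amul x z.
  by move=> yy; rewrite amulA -(amulA x) yy amulr1.
have baE : ainv (amul b a) = amul a b by apply: ainv_uniq baV; rewrite mid.
have acE : ainv (amul a c) = amul c a by apply: ainv_uniq acV; rewrite mid.
move=> g h [] -> [] ->.
- by exists [::]; rewrite aa.
- by exists (winv y2); rewrite /weval /= amulr1 baE.
- by exists y3; rewrite /weval /= amulr1.
- by exists y2; rewrite /weval /= amulr1.
- by exists [::]; rewrite bb.
- by exists (y2 ++ y3); rewrite /weval /= amulr1 mid.
- by exists (winv y3); rewrite /weval /= amulr1 acE.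
- by exists (winv y3 ++ winv y2); rewrite /weval /= amulr1 baE acE mid.
- by exists [::]; rewrite cc.
Qed.

End InvolutionPairs.

Section EvenWords.
Variables (R : realType) (A1 A2 A3 : 'rV[R]_2).
Hypotheses (d1 : A3 - A2 != 0) (d2 : A1 - A3 != 0) (d3 : A2 - A1 != 0).

Let r (i : 'I_3) : aff R := [:: r1 A1 A2 A3; r2 A1 A2 A3; r3 A1 A2 A3]`_i.
Let g2 := amul (r2 A1 A2 A3) (r1 A1 A2 A3).
Let g3 := amul (r1 A1 A2 A3) (r3 A1 A2 A3).
Let rprod (s : seq 'I_3) : aff R := foldr (fun i acc => amul (r i) acc) (aone R) s.

Hypotheses (g2V : amul g2 (ainv g2) = aone R) (g3V : amul g3 (ainv g3) = aone R).

Lemma ord3P (i : 'I_3) :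
  [\/ r i = r1 A1 A2 A3, r i = r2 A1 A2 A3 | r i = r3 A1 A2 A3].
Proof.
by case: i => -[|[|[|//]]] ?; [apply: Or31 | apply: Or32 | apply: Or33].
Qed.

Lemma det_rprod s : \det (rprod s).1 = (-1) ^+ size s.
Proof.
elim: s => [|i s IH]; first by rewrite /= det1.
rewrite /= det_mulmx IH exprS; congr (_ * _).
by case: (ord3P i) => ->; rewrite /= det_reflM.
Qed.

Lemma pair_word i j : exists w, weval g2 g3 w = amul (r i) (r j).
Proof.
have r11 : amul (r1 A1 A2 A3) (r1 A1 A2 A3) = aone R by exact: refl_mulK.
have r22 : amul (r2 A1 A2 A3) (r2 A1 A2 A3) = aone R by exact: refl_mulK.
have r33 : amul (r3 A1 A2 A3) (r3 A1 A2 A3) = aone R by exact: refl_mulK.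
exact: (involution_pair_word r11 r22 r33 g2V g3V (ord3P i) (ord3P j)).
Qed.

Lemma even_word s : ~~ odd (size s) -> exists w, weval g2 g3 w = rprod s.
Proof.
have [n] := ubnP (size s); elim: n s => // n IH [|i [|j s]] //= ns es.
  by exists [::].
have [||w ew] := IH s; [exact: ltn_trans (ltnSn _) ns | by rewrite negbK in es |].
have [w' ew'] := pair_word i j.
by exists (w' ++ w); rewrite weval_cat ew ew' amulA.
Qed.

(** Each reflection has determinant -1, so determinant 1 forces an even number of letters, which are
    then grouped in pairs. *)
Lemma in_H_word h : in_H A1 A2 A3 h -> exists w, weval g2 g3 w = h.
Proof.
case=> -[s ->]; rewrite -/(rprod s) det_rprod => ds; apply: even_word.
apply: contra_eqN ds => os; rewrite -signr_odd os expr1.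
by rewrite eqNr oner_eq0.
Qed.

Lemma in_H_gens : in_H A1 A2 A3 g2 /\ in_H A1 A2 A3 g3.
Proof.
have rp i j : in_H A1 A2 A3 (amul (r i) (r j)).
  split; first by exists [:: i; j]; rewrite /= amulr1.
  have := det_rprod [:: i; j]; rewrite /rprod /= mulmx1 => ->.
  by rewrite sqrrN expr1n.
split; first exact: (rp (@Ordinal 3 1 isT) (@Ordinal 3 0 isT)).
exact: (rp (@Ordinal 3 0 isT) (@Ordinal 3 2 isT)).
Qed.

End EvenWords.

(* H_tau is presented by <y2,y3 | [c, (y2^n y3^m)^-1 c (y2^n y3^m)], (n,m)>(0,0)>
   via y2 |-> r2 r1, y3 |-> r1 r3: the induced map from words is onto H_tau,
   and a word maps to the identity iff it is trivial in the presented group. *)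
Theorem theorem5p2 (R : realType) (A1 A2 A3 : 'rV[R]_2) :
  is_triangle A1 A2 A3 -> generic_triangle A1 A2 A3 ->
  let g2 := amul (r2 A1 A2 A3) (r1 A1 A2 A3) in
  let g3 := amul (r1 A1 A2 A3) (r3 A1 A2 A3) in
  in_H A1 A2 A3 g2 /\ in_H A1 A2 A3 g3 /\
  (forall h, in_H A1 A2 A3 h -> exists w, weval g2 g3 w = h) /\
  (forall w, weval g2 g3 w = aone R <-> pres_eq w [::]).
Proof.
move=> tri gen g2 g3.
have [d1 d2 d3] := And3 (edge1_neq0 tri) (edge2_neq0 tri) (edge3_neq0 tri).
pose u2 := reflect_quot (A1 - A3) (A3 - A2).
pose u3 := reflect_quot (A3 - A2) (A2 - A1).
have indep : forall s t : seq (int * int),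
    \sum_(z <- s) u2 ^ z.1 * u3 ^ z.2 = \sum_(z <- t) u2 ^ z.1 * u3 ^ z.2 ->
    perm_eq s t by exact: angles_independent tri gen.
have quot_neq0 d e : d != 0 -> e != 0 -> @reflect_quot R d e != 0.
  by move=> d0 e0; rewrite !mulf_neq0 ?invr_eq0 ?conjc_eq0 ?cplx_eq0.
have u20 : u2 != 0 by apply: quot_neq0.
have u30 : u3 != 0 by apply: quot_neq0.
(* If [u2] were 1, the exponents [(1, 0)] and [(0, 0)] would give equal sums, against
   independence. *)
have u21 : 1 - u2 != 0.
  rewrite subr_eq0; apply/eqP => e1; have := indep [:: (1, 0)] [:: (0, 0)].
  by rewrite !big_seq1 /= !expr0z expr1z -e1 mulr1 => /(_ erefl).
have u31 : 1 - u3 != 0.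
  rewrite subr_eq0; apply/eqP => e1; have := indep [:: (0, 1)] [:: (0, 0)].
  by rewrite !big_seq1 /= !expr0z expr1z -e1 mulr1 => /(_ erefl).
(* The centre of each rotation is the vertex shared by its two mirrors: [A3] for [g2] and [A2] for
   [g3]. *)
have g2E : g2 = rigid u2 (cplx A3 * (1 - u2)).
  by apply: amul_refl => //; [apply: refl_fixl | apply: refl_fixr].
have g3E : g3 = rigid u3 (cplx A2 * (1 - u3)).
  by apply: amul_refl => //; [apply: refl_fixl | apply: refl_fixr].
have g2V : amul g2 (ainv g2) = aone R by rewrite g2E amul_ainv_rigid.
have g3V : amul g3 (ainv g3) = aone R by rewrite g3E amul_ainv_rigid.
have [H2 H3] := in_H_gens d1 d2 d3.
split; first exact: H2.
split; first exact: H3.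
split=> [h|w]; first exact: (in_H_word d1 d2 d3 g2V g3V).
rewrite g2E g3E; apply: weval_kernel => //.
(* The commutator is a nonzero translation because the two centres differ and neither rotation is
   trivial. *)
have -> : cplx A3 * (1 - u2) * (u3 - 1) + cplx A2 * (1 - u3) * (1 - u2) =
    - (cplx (A3 - A2) * (1 - u2) * (1 - u3)) by rewrite cplxB; ring.
have tau0 : cplx (A3 - A2) * (1 - u2) * (1 - u3) != 0.
  by rewrite !mulf_neq0 // cplx_eq0.
by rewrite mulf_neq0 ?oppr_eq0 // invr_eq0 mulf_neq0.
Qed.
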